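(* Let $G$ be a connected finite simple graph on $n$ vertices and let $1\le k\le n-1$ be an integer. Then $\operatorname{Aut}(F_k(G))$ contains a subgroup $\mathcal{G}$ with \[\mathcal{G}\cong\begin{cases}\mathbb{Z}_2\wr_{\mathcal{T}_G}\iota(\mathcal{S}) & \text{if } k\ne n/2;\\ \mathbb{Z}_2\wr_{\mathcal{T}_G}\left(\iota(\mathcal{S})\times\mathbb{Z}_2\right) & \text{if } k=n/2;\end{cases}\] such that $\iota(\operatorname{Aut}(G))\le\mathcal{G}$.
   Context: The $k$-token graph $F_k(G)$ is the graph whose vertices are all $k$-subsets of $V(G)$, where $A$ and $B$ are adjacent whenever $A\triangle B$ is an edge of $G$. The injective group homomorphism $\iota:\operatorname{Aut}(G)\to\operatorname{Aut}(F_k(G))$ is given by $\iota(f)(\{a_1,\dots,a_k\})=\{f(a_1),\dots,f(a_k)\}$. When $k=n/2$, $\mathfrak{c}\in\operatorname{Aut}(F_k(G))$ is given by $\mathfrak{c}(A)=V(G)\setminus A$. A 2-cut with the same neighbours of $G$ is a set $S=\{x,y\}$ of two distinct vertices such that $G\setminus S$ is disconnected and $x$ and $y$ have the same neighbours in $V(G)\setminus S$. Let $Q(G)$ be the set of all 2-cuts with the same neighbours of $G$, $q(G)=|Q(G)|$, and let $S_1,\dots,S_{q(G)}$ be its elements in any given but fixed order. For each $i$ fix a labelling $S_i=\{x_i,y_i\}$ and a fixed order of the connected components of $G\setminus S_i$. For $S\in Q(G)$, let $G_1,\dots,G_{c_S}$ be the components of $G\setminus S$ in their fixed order. Let $T_S$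 be the set of integer tuples $(k_1,\dots,k_{c_S})$ with $0\le k_j\le|V(G_j)|$ for every $j$ and $\sum_j k_j=k-1$. For $t\in T_S$, with $j$-th coordinate $t(j)$, let $V_{S,t}$ be the set of $A\in V(F_k(G))$ with $|A\cap V(G_j)|=t(j)$ for every $j$. Let $\mathcal{T}_G$ be the disjoint union of the sets $T_{S_i}$, $1\le i\le q(G)$. Each $f\in\operatorname{Aut}(G)$ permutes $Q(G)$; write $f(S_i)=S_{f(i)}$. The group $\operatorname{Aut}(G)$ acts on $\mathcal{T}_G$ as follows: for $t=(k_1,\dots,k_r)\in T_{S_i}$, where $k_j$ corresponds to the component $G_j$ of $G\setminus S_i$, $ft$ is the element of $T_{S_{f(i)}}$ whose coordinate at the component $f(G_j)$ of $G\setminus S_{f(i)}$ is $k_j$, for every $j$; equivalently, $A\in V_{S_i,t}$ if and only if $f(A)\in V_{S_{f(i)},ft}$. When $k=n/2$, $\mathfrak{c}$ acts on $\mathcal{T}_G$ by sending $t=(k_1,\dots,k_r)\in T_{S_i}$ to $\mathfrak{c}t:=(|V(G_1)|-k_1,\dots,|V(G_r)|-k_r)\in T_{S_i}$. Let $\mathcal{S}:=\{f\in\operatorname{Aut}(G): f(x_i)=x_{f(i)}\text{ for every }1\le i\le q(G)\}$, a subgroup of $\operatorname{Aut}(G)$. The group $\iota(\mathcal{S})$ acts on $\mathcal{T}_G$ through the action of $\mathcal{S}$, i.e. $\iota(f)t=ft$; when $k=n/2$, in $\iota(\mathcal{S})\times\mathbb{Z}_2$ the generator of the factor $\mathbb{Z}_2$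 corresponds to $\mathfrak{c}$ and acts on $\mathcal{T}_G$ as $\mathfrak{c}$ does. For a group $K$ acting on a finite set $\Omega$, $\mathbb{Z}_2\wr_\Omega K$ denotes the wreath product, i.e. the semidirect product $\mathbb{Z}_2^{\Omega}\rtimes K$ in which $K$ permutes the coordinates of $\mathbb{Z}_2^\Omega$ according to its action on $\Omega$, that is $(\kappa\cdot v)(\omega)=v(\kappa^{-1}\omega)$.
   Formalization: Two pairs are excluded because the claim fails there: G = K_2 with k = 1 (the wreath product has order 4, but Aut(F_1(K_2)) has order 2) and G = C_4 with k = 2 (order 64, but F_2(C_4) = K_{2,4} has 48 automorphisms). *)

(* Defs.v *)
From mathcomp Require Import all_boot all_fingroup.
From mathcomp Require Import ssralg zmodp.

Set Implicit Arguments.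
Unset Strict Implicit.
Unset Printing Implicit Defensive.

Import GroupScope.

Record sgraph := SGraph {
  vertex :> finType;
  edge : rel vertex;
  edge_sym : symmetric edge;
  edge_irr : irreflexive edge }.

Definition connected_graph (G : sgraph) : Prop :=
  forall u v : G, connect (@edge G) u v.

(* The 4-cycle with k = 2 is a genuine exception: its 2-token graph is K_{2,4},
   with 48 automorphisms, while the wreath product has order 64.  The only
   other one is K_2 with k = 1: there the wreath product has order 4, but the
   1-token graph has 2 automorphisms. *)
Definition is_cycle4 (G : sgraph) : Prop :=
  exists2 f : 'I_4 -> G, bijective f &
    forall i j : 'I_4,
      edge (f i) (f j) = (j == i.+1 %[mod 4]) || (i == j.+1 %[mod 4]).

(* Permutations compose in diagrammatic order, (f * g) x = g (f x); hence the
   left actions of the usual convention are the right actions of the library. *)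
Section RelAut.
Variables (T : finType) (r : rel T).

Definition aut_rel : {set {perm T}} :=
  [set f : {perm T} | [forall u, forall v, r (f u) (f v) == r u v]].

Lemma aut_relP (f : {perm T}) :
  reflect (forall u v, r (f u) (f v) = r u v) (f \in aut_rel).
Proof.
rewrite inE; apply: (iffP 'forall_forallP) => H u v; first exact/eqP/H.
by rewrite H.
Qed.

Lemma aut_rel_group_set : group_set aut_rel.
Proof.
apply/group_setP; split; first by apply/aut_relP => u v; rewrite !perm1.
move=> f g /aut_relP Hf /aut_relP Hg; apply/aut_relP => u v.
by rewrite !permM Hg Hf.
Qed.
Canonical aut_rel_group := Group aut_rel_group_set.
End RelAut.

Notation "''Aut' G" := (aut_rel (@edge G)) (at level 8, G at level 2).

Section Wreath.
Variables (aT : finGroupType) (K : {group aT}) (Om : finType).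
Variable (to : action K Om).

Local Notation base := {dffun forall _ : Om, 'Z_2}.

Definition wr_act (v : base) (a : aT) : base := [ffun w => v (to w a^-1)].

Lemma wr_is_action : is_action K wr_act.
Proof.
split=> [a u v /ffunP uv|v a b Ka Kb].
  apply/ffunP => w; have := uv (invF (act_inj to a^-1) w).
  by rewrite !ffunE; have /= -> := f_invF (act_inj to a^-1) w.
by apply/ffunP => w; rewrite !ffunE invMg actMin ?groupV.
Qed.
Canonical wr_action := Action wr_is_action.

Lemma wr_is_groupAction : is_groupAction [set: base] wr_action.
Proof.
move=> a Ka; rewrite inE; apply/andP; split.
  by apply/subsetP => v _; rewrite inE.
apply/morphicP => u v _ _; rewrite !actpermE /=.
by apply/ffunP => w; rewrite !ffunE.
Qed.
Canonical wr_groupAction := GroupAction wr_is_groupAction.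

Definition wreathZ2 : finGroupType := sdprod_by wr_groupAction.
End Wreath.

Section ProdZ2Act.
Variables (aT : finGroupType) (K : {group aT}) (Om : finType).
Variables (to : action K Om) (c : Om -> Om).
Hypothesis cK : involutive c.
Hypothesis c_to : forall w a, a \in K -> c (to w a) = to (c w) a.

(* The generator of the factor Z_2 acts as c. *)
Definition prodZ2_act (w : Om) (p : aT * 'Z_2) : Om :=
  if p.2 == 0%R then to w p.1 else c (to w p.1).

Lemma prodZ2_is_action : is_action (setX K [set: 'Z_2]) prodZ2_act.
Proof.
split=> [[a z] u v|w [a y] [b z]]; rewrite /prodZ2_act /=.
  by case: ifP => _; [move/act_inj | move/(can_inj cK)/act_inj].
case/setXP=> /= Ka _ /setXP[/= Kb _]; rewrite actMin //.
case: y => [[|[|//]] ?]; case: z => [[|[|//]] ?] //=; rewrite ?c_to //.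
by rewrite ?groupM // cK.
Qed.
Definition prodZ2_action := Action prodZ2_is_action.
End ProdZ2Act.

Section TokenGraph.
Variables (G : sgraph) (k : nat).

Definition token_vertex := {A : {set G} | #|A| == k}.

Definition symdiff (A B : {set G}) := (A :\: B) :|: (B :\: A).

Definition token_edge : rel token_vertex := fun A B =>
  [exists u, exists v, edge u v && (symdiff (val A) (val B) == [set u; v])].

Lemma iota_proof (f : {perm G}) (A : token_vertex) : #|f @: val A| == k.
Proof. by rewrite card_imset ?(valP A) //; apply: perm_inj. Qed.

Definition iota_fun (f : {perm G}) (A : token_vertex) : token_vertex :=
  Sub (f @: val A) (iota_proof f A).

Lemma iota_fun_inj f : injective (iota_fun f).
Proof.
move=> A B /(congr1 val) /= /imset_inj AB; apply/val_inj/AB; exact: perm_inj.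
Qed.

Definition tok_iota (f : {perm G}) : {perm token_vertex} :=
  perm (@iota_fun_inj f).

Lemma tok_iotaM : {in 'Aut G &, {morph tok_iota : f g / f * g}}.
Proof.
move=> f g _ _; apply/permP => A; rewrite permM !permE; apply: val_inj => /=.
by rewrite -imset_comp; apply: eq_imset => x; rewrite /= permM.
Qed.
Canonical iota_morphism := Morphism tok_iotaM.

Lemma injm_iota : 0 < k < #|G| -> 'injm tok_iota.
Proof.
case/andP=> k_gt0 k_lt; apply/subsetP => f /morphpreP[_ /set1P fE].
apply/set1P/permP => v; rewrite perm1; apply/eqP; apply/negPn/negP => fv.
pose W := ~: [set v; f v].
have cW : k.-1 <= #|W|.
  by move: (cardsC [set v; f v]); rewrite cards2 eq_sym fv /W; move: k_lt;
    case: (k) k_gt0 => //= m _ + E; rewrite -E addSn add1n !ltnS.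
pose B := [set x in take k.-1 (enum W)].
have BW x : x \in B -> x \in W.
  by rewrite inE => /mem_take; rewrite mem_enum.
have cB : #|B| = k.-1.
  rewrite cardsE; have /card_uniqP-> : uniq (take k.-1 (enum W)).
    by rewrite take_uniq // enum_uniq.
  by rewrite size_takel // -cardE.
have vB : v \notin B by apply/negP => /BW; rewrite !inE eqxx.
have cA : #|v |: B| == k by rewrite cardsU1 vB cB add1n prednK.
have := congr1 val (congr1 (fun p : {perm _} => p (Sub (v |: B) cA)) fE).
rewrite perm1 permE /= => E.
have: f v \in v |: B by rewrite -E imset_f // !inE eqxx.
by rewrite !inE (negPf fv) /= => /mem_take; rewrite mem_enum !inE eqxx orbT.
Qed.

Definition del_edge (S : {set G}) : rel G :=
  fun u v => [&& u \notin S, v \notin S & edge u v].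

Definition components (S : {set G}) : {set {set G}} :=
  equivalence_partition (connect (del_edge S)) (~: S).

(* The graph with no vertices does not count as disconnected. *)
Definition disconnects (S : {set G}) : bool :=
  [exists u in ~: S, exists v in ~: S, ~~ connect (del_edge S) u v].

Definition same_nbr_cuts : {set {set G}} :=
  [set S : {set G} | disconnects S &&
     [exists x, exists y, [&& x != y, S == [set x; y] &
        [forall z in ~: S, edge x z == edge y z]]]].

(* A tuple of T_S is indexed by the components of G \ S themselves rather than
   by their positions in some order, and extended by 0 to all other subsets of
   vertices. *)
Definition tuples := {ffun {set G} -> 'I_#|G|.+1}.

Definition TS (S : {set G}) : {set tuples} :=
  [set t : tuples |
     [&& [forall C in components S, t C <= #|C|],
         [forall C in ~: components S, t C == 0 :> nat]
       & \sum_(C in components S) t C == k.-1]].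

(* The disjoint union of the sets TS S, S a 2-cut with the same neighbours. *)
Definition TG :=
  {p : {set G} * tuples | (p.1 \in same_nbr_cuts) && (p.2 \in TS p.1)}.

Lemma TS_P S (t : tuples) :
  reflect [/\ forall C, C \in components S -> t C <= #|C|,
              forall C, C \notin components S -> t C = ord0
            & \sum_(C in components S) t C = k.-1] (t \in TS S).
Proof.
rewrite inE; apply: (iffP and3P) => [[H1 H2 /eqP H3]|[H1 H2 H3]]; split=> //.
- by move=> C; apply/implyP/(forallP H1).
- move=> C nC; apply/val_inj/eqP; move/forallP/(_ C)/implyP: H2.
  by rewrite inE; apply.
- by apply/forallP => C; apply/implyP => /H1.
- by apply/forallP => C; apply/implyP; rewrite inE => /H2->.
- exact/eqP.
Qed.

Lemma componentsP (S C : {set G}) :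
  reflect (exists2 u, u \notin S &
             C = [set v | (v \notin S) && connect (del_edge S) u v])
          (C \in components S).
Proof.
have E u : [set v in ~: S | connect (del_edge S) u v] =
           [set v | (v \notin S) && connect (del_edge S) u v].
  by apply/setP => v; rewrite !inE.
apply: (iffP imsetP) => [[u uS ->]|[u uS ->]]; exists u.
- by rewrite inE in uS.
- exact: E.
- by rewrite inE.
- by rewrite E.
Qed.

Lemma aut_del_edge f (S : {set G}) : f \in 'Aut G ->
  forall u v, del_edge (f @: S) (f u) (f v) = del_edge S u v.
Proof.
move=> /aut_relP fG u v.
by rewrite /del_edge !(mem_imset _ _ (@perm_inj _ f)) fG.
Qed.

Lemma aut_connect1 f (S : {set G}) u v : f \in 'Aut G ->
  connect (del_edge S) u v -> connect (del_edge (f @: S)) (f u) (f v).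
Proof.
move=> fG /connectP[p pP ->]; apply/connectP; exists (map f p).
  elim: p u pP => //= w p IH u /andP[uw /IH->].
  by rewrite aut_del_edge // uw.
by rewrite last_map.
Qed.

Lemma imset_permV (f : {perm G}) (A : {set G}) : f^-1 @: (f @: A) = A.
Proof.
by rewrite -imset_comp (eq_imset (g := id)) ?imset_id // => x; rewrite /= permK.
Qed.

Lemma aut_connect f (S : {set G}) u v : f \in 'Aut G ->
  connect (del_edge (f @: S)) (f u) (f v) = connect (del_edge S) u v.
Proof.
move=> fG; apply/idP/idP; last exact: aut_connect1.
move/(@aut_connect1 f^-1); rewrite groupV => /(_ fG).
by rewrite imset_permV !permK.
Qed.

Lemma aut_component1 f (S C : {set G}) : f \in 'Aut G ->
  C \in components S -> f @: C \in components (f @: S).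
Proof.
move=> fG /componentsP[u uS ->]; apply/componentsP; exists (f u).
  by rewrite (mem_imset _ _ (@perm_inj _ f)).
apply/setP => v; rewrite -(permKV f v) (mem_imset _ _ (@perm_inj _ f)) !inE.
by rewrite aut_connect // (mem_imset _ _ (@perm_inj _ f)).
Qed.

Lemma aut_component f (S C : {set G}) : f \in 'Aut G ->
  (f @: C \in components (f @: S)) = (C \in components S).
Proof.
move=> fG; apply/idP/idP; last exact: aut_component1.
move/(@aut_component1 f^-1); rewrite groupV => /(_ fG).
by rewrite !imset_permV.
Qed.

Lemma same_nbr_cuts_aut f S : f \in 'Aut G ->
  S \in same_nbr_cuts -> f @: S \in same_nbr_cuts.
Proof.
move=> fG; have fGr := aut_relP _ _ fG; rewrite !inE => /andP[/existsP[u]].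
rewrite inE => /andP[uS /existsP[v]]; rewrite inE => /andP[vS nuv].
case/existsP=> x /existsP[y /and3P[xy /eqP SE /forallP H]]; apply/andP; split.
  apply/existsP; exists (f u); rewrite inE (mem_imset _ _ (@perm_inj _ f)) uS.
  apply/existsP; exists (f v); rewrite inE (mem_imset _ _ (@perm_inj _ f)) vS.
  by rewrite aut_connect.
apply/existsP; exists (f x); apply/existsP; exists (f y).
rewrite (inj_eq (@perm_inj _ f)) xy SE imsetU1 imset_set1 eqxx /=.
apply/forallP => z; apply/implyP.
have [w ->] : exists w, z = f w by exists (f^-1 z); rewrite permKV.
move/implyP: (H w); rewrite SE !fGr !inE !(inj_eq (@perm_inj _ f)).
exact.
Qed.

(* raw_act (S, t) f has coordinate t C at f @: C. *)
Definition raw_act (p : {set G} * tuples) (f : {perm G}) : {set G} * tuples :=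
  (f @: p.1, [ffun C : {set G} => p.2 (f @^-1: C)]).

Lemma raw_act1 : raw_act^~ 1 =1 id.
Proof.
have i1 (A : {set G}) : (1 : {perm G}) @^-1: A = A.
  by apply/setP => x; rewrite inE perm1.
case=> S t; rewrite /raw_act /=; congr (_, _).
  by rewrite (eq_imset (g := id)) ?imset_id // => x; rewrite perm1.
by apply/ffunP => C; rewrite ffunE i1.
Qed.

Lemma raw_actM p : act_morph raw_act p.
Proof.
case: p => S t f g; rewrite /raw_act /=; congr (_, _).
  by rewrite -imset_comp; apply: eq_imset => x; rewrite /= permM.
apply/ffunP => C; rewrite !ffunE; congr (t _).
by apply/setP => x; rewrite !inE permM.
Qed.

Definition raw_action := TotalAction raw_act1 raw_actM.

Lemma preim_imset_perm (f : {perm G}) (C : {set G}) : f @^-1: (f @: C) = C.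
Proof. by apply/setP => x; rewrite inE (mem_imset _ _ (@perm_inj _ f)). Qed.

Lemma imset_preim_perm (f : {perm G}) (C : {set G}) : f @: (f @^-1: C) = C.
Proof.
apply/setP => x; rewrite -(permKV f x) (mem_imset _ _ (@perm_inj _ f)).
by rewrite inE.
Qed.

Lemma TS_aut f S t : f \in 'Aut G ->
  t \in TS S -> (raw_act (S, t) f).2 \in TS (f @: S).
Proof.
move=> fG /TS_P[H1 H2 H3]; apply/TS_P; split=> [C|C|].
- rewrite ffunE -{1 3}(imset_preim_perm f C) aut_component // => /H1.
  by rewrite card_imset //; apply: perm_inj.
- by rewrite ffunE -{1}(imset_preim_perm f C) aut_component // => /H2.
rewrite -H3 (reindex (fun C : {set G} => f @: C)) /=.
  by apply: eq_big => C; rewrite ?aut_component // ffunE preim_imset_perm.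
exists (fun C : {set G} => f @^-1: C) => C _.
  exact: preim_imset_perm.
exact: imset_preim_perm.
Qed.

Lemma aut_sub_dom :
  'Aut G \subset
    subact_dom (fun p => (p.1 \in same_nbr_cuts) && (p.2 \in TS p.1))
      raw_action.
Proof.
apply/subsetP => f fG; rewrite !inE /=; apply/subsetP => -[S t].
rewrite in_set => /andP[/= SQ tS]; rewrite in_set in_set /=.
by rewrite same_nbr_cuts_aut //; have := TS_aut fG tS.
Qed.

Definition TG_action : action 'Aut G TG :=
  ([action of raw_action^?] \ aut_sub_dom)%act.

Lemma val_TG_action (p : TG) f : f \in 'Aut G ->
  val (TG_action p f) = raw_act (val p) f.
Proof.
by move=> fG; rewrite /= /ract val_subact (subsetP aut_sub_dom).
Qed.

Lemma components_partition (S : {set G}) : partition (components S) (~: S).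
Proof.
apply: equivalence_partitionP => u v w _ _ _; split; first exact: connect0.
have sym : connect_sym (del_edge S).
  by apply: sym_connect_sym => a b; rewrite /del_edge edge_sym andbCA.
move=> uv; apply/idP/idP; last exact: connect_trans.
by apply: connect_trans; rewrite sym.
Qed.

Definition raw_c (p : {set G} * tuples) : {set G} * tuples :=
  (p.1, [ffun C : {set G} =>
           if C \in components p.1 then inord (#|C| - p.2 C) else ord0]).

Lemma raw_cE S t C : C \in components S ->
  (raw_c (S, t)).2 C = #|C| - t C :> nat.
Proof.
move=> CS; rewrite ffunE CS inordK // ltnS.
by rewrite (leq_trans (leq_subr _ _)) // max_card.
Qed.

Lemma raw_cK S t : t \in TS S -> raw_c (raw_c (S, t)) = (S, t).
Proof.
move/TS_P => [H1 H2 _]; congr (_, _); apply/ffunP => C; rewrite ffunE /=.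
case: ifP => [CS|/negbT/H2-> //]; apply/val_inj; rewrite /= raw_cE //.
by rewrite subKn ?H1 // inordK.
Qed.

Lemma card_same_nbr_cuts S : S \in same_nbr_cuts -> #|S| = 2.
Proof.
rewrite inE => /andP[_ /existsP[x /existsP[y /and3P[xy /eqP-> _]]]].
by rewrite cards2 xy.
Qed.

Lemma TS_raw_c S t : k.*2 = #|G| -> S \in same_nbr_cuts -> t \in TS S ->
  (raw_c (S, t)).2 \in TS S.
Proof.
move=> kG SQ /TS_P[H1 H2 H3]; apply/TS_P; split=> [C CS|C CS|].
- by rewrite raw_cE // leq_subr.
- by rewrite ffunE (negPf CS).
rewrite (eq_bigr (fun C : {set G} => #|C| - t C)); last first.
  by move=> C CS; rewrite raw_cE.
rewrite sumnB // H3 -(card_partition (components_partition S)).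
have := cardsC S; rewrite (card_same_nbr_cuts SQ) -kG.
by case: (k) => [|m] //=; rewrite add2n doubleS => -[->]; rewrite -addnn addnK.
Qed.

Section Complement.
Hypothesis kG : k.*2 = #|G|.

Lemma TG_c_proof (p : TG) :
  ((raw_c (val p)).1 \in same_nbr_cuts) &&
  ((raw_c (val p)).2 \in TS (raw_c (val p)).1).
Proof. by case: p => [[S t] /= /andP[SQ tS]]; rewrite SQ TS_raw_c. Qed.

(* The action of A |-> V(G) \ A. *)
Definition TG_c (p : TG) : TG := Sub (raw_c (val p)) (TG_c_proof p).

Lemma TG_cK : involutive TG_c.
Proof.
by move=> p; apply: val_inj; case: p => [[S t] /= /andP[SQ tS]]; apply: raw_cK.
Qed.

Lemma TG_c_action p f : f \in 'Aut G ->
  TG_c (TG_action p f) = TG_action (TG_c p) f.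
Proof.
move=> fG; apply: val_inj; rewrite [RHS]val_TG_action //=.
have -> : raw_c (val (TG_action p f)) = raw_c (raw_act (val p) f).
  by rewrite val_TG_action.
case: p => [[S t] /= _]; apply: injective_projections => //=.
apply/ffunP => C; rewrite !ffunE /=.
rewrite -[in LHS](imset_preim_perm f C) aut_component // preim_imset_perm.
by rewrite card_imset //; apply: perm_inj.
Qed.
End Complement.

Section Labelling.
(* x S is the first vertex of S in its fixed labelling {x, y}. *)
Variable x : {set G} -> G.

Definition label_pres : {set {perm G}} :=
  [set f in 'Aut G | [forall S in same_nbr_cuts, f (x S) == x (f @: S)]].

Lemma label_pres_group_set : group_set label_pres.
Proof.
apply/group_setP; split.
  apply/setIdP; split; first exact: group1.
  apply/forall_inP => S _; rewrite perm1.
  by rewrite (eq_imset (g := id)) ?imset_id // => u; rewrite perm1.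
move=> f g /setIdP[fG /forall_inP Hf] /setIdP[gG /forall_inP Hg].
apply/setIdP; split; first exact: groupM.
apply/forall_inP => S SQ; rewrite permM (eqP (Hf S SQ)).
rewrite (eqP (Hg _ (same_nbr_cuts_aut fG SQ))) -imset_comp.
by rewrite (eq_imset (g := g \o f)) // => u; rewrite permM.
Qed.
Canonical label_pres_group := Group label_pres_group_set.

Definition iotaS : {group {perm token_vertex}} := (tok_iota @* label_pres)%G.

Section IotaS.
Hypothesis hk : 0 < k < #|G|.

Lemma iotaS_sub_dom :
  iotaS \subset invm (injm_iota hk) @*^-1 'Aut G.
Proof.
apply/subsetP => _ /morphimP[f fG _ ->]; apply/morphpreP; split.
  exact: mem_morphim.
by rewrite /= invmE.
Qed.

(* iota(f) acts as f: see iotaS_actionE. *)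
Definition iotaS_action : action iotaS TG :=
  ((TG_action \o invm (injm_iota hk)) \ iotaS_sub_dom)%act.

Lemma iotaS_actionE p f : f \in 'Aut G ->
  iotaS_action p (tok_iota f) = TG_action p f.
Proof. by move=> fG; rewrite /= /ract /= /comp_act /= invmE. Qed.

Lemma TG_c_iotaS (kG : k.*2 = #|G|) p g : g \in iotaS ->
  TG_c kG (iotaS_action p g) = iotaS_action (TG_c kG p) g.
Proof.
case/morphimP=> f fG _ ->; rewrite !iotaS_actionE //; exact: TG_c_action.
Qed.

Definition iotaS_Z2_action (kG : k.*2 = #|G|) :
    action (setX iotaS [set: 'Z_2]) TG :=
  prodZ2_action (TG_cK kG) (TG_c_iotaS kG).
End IotaS.
End Labelling.

End TokenGraph.

(* Main.v *)
Require Import Defs.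
From mathcomp Require Import all_boot all_fingroup.
From mathcomp Require Import ssralg zmodp.
Import GroupScope.

(* Let S = {x, y} be a 2-cut with the same neighbours and let t prescribe the
   number of tokens on each component of G \ S, k - 1 in total.  Exchanging x
   and y in the token sets of type (S, t) is an automorphism tau of F_k(G):
   an edge of F_k(G) between a set of this type and one of another type moves
   a token between S and its complement, and x and y are twins.  Distinct cuts
   are disjoint, and two cuts carrying one token each do not separate one
   another unless G is a 4-cycle and k = 2; hence each tau preserves the types
   of all token sets, the tau's commute, and they generate a copy of the base
   group.  An automorphism of G, or the complement when k = n/2, permutes
   the tau's by conjugation as it permutes the types.  A composite of tau's only
   exchanges twins, so it is not induced by a nontrivial label-preserving
   automorphism, with or without the complement.  Finally, the exchange of x
   and y is an automorphism of G induced by the product of the tau's of all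
   types at S, so every automorphism of G becomes label-preserving modulo the
   base group. *)

Set Implicit Arguments.
Unset Strict Implicit.
Unset Printing Implicit Defensive.

(** * 2-cuts with the same neighbours *)

Section Cuts.
Variable G : sgraph.
Implicit Types (S C : {set G}) (a b u v z : G).

Lemma del_edge_connect_sym S : connect_sym (del_edge S).
Proof. by apply: sym_connect_sym => a b; rewrite /del_edge edge_sym andbCA. Qed.

Lemma component_connect S C a b : C \in components S -> a \in C ->
  (b \in C) = (b \notin S) && connect (del_edge S) a b.
Proof.
case/componentsP=> u uS ->; rewrite !inE => /andP[aS ua].
by case: (b \notin S) => //=; apply/(same_connect (@del_edge_connect_sym S)).
Qed.

Lemma component_notin S C a : C \in components S -> a \in C -> a \notin S.
Proof. by case/componentsP=> u uS ->; rewrite inE => /andP[]. Qed.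

Lemma components_eq S C C' a : C \in components S -> C' \in components S ->
  a \in C -> a \in C' -> C = C'.
Proof.
move=> CS CS' aC aC'; apply/setP => b.
by rewrite (component_connect _ CS aC) (component_connect _ CS' aC').
Qed.

Lemma cut_twins S u v z : S \in same_nbr_cuts G ->
  u \in S -> v \in S -> z \notin S -> edge u z = edge v z.
Proof.
rewrite inE => /andP[_ /existsP[x /existsP[y /and3P[_ /eqP-> /forallP H]]]].
move=> uS vS zS; have /eqP xz := implyP (H z) ltac:(by rewrite inE).
by move: uS vS; rewrite !inE => /orP[]/eqP-> /orP[]/eqP->.
Qed.

Lemma cut_disconnected S : S \in same_nbr_cuts G ->
  exists a b, [/\ a \notin S, b \notin S & ~~ connect (del_edge S) a b].
Proof.
rewrite inE => /andP[/existsP[a]]; rewrite inE => /andP[aS /existsP[b]].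
by rewrite inE => /andP[bS nab] _; exists a, b.
Qed.

Lemma cut_pair S a b : S \in same_nbr_cuts G -> a \in S -> b \in S -> a != b ->
  S = [set a; b].
Proof.
move=> SQ aS bS ab; apply/esym/eqP; rewrite eqEcard (card_same_nbr_cuts SQ).
by rewrite cards2 ab andbT; apply/subsetP => z /set2P[]->.
Qed.

Lemma cut_other S a : S \in same_nbr_cuts G -> a \in S ->
  exists2 b, a != b & S = [set a; b].
Proof.
move=> SQ aS; have /card_gt0P[b /setD1P[ba bS]] : 0 < #|S :\ a|.
  by have := cardsD1 a S; rewrite (card_same_nbr_cuts SQ) aS add1n => -[<-].
by exists b; [rewrite eq_sym | apply: cut_pair; rewrite // eq_sym].
Qed.

Hypothesis Gconn : connected_graph G.

(** If the component of a in G \ S had no neighbour of u, it would have no neighbour in S at all,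
    since the vertices of S are twins. It would then be closed under adjacency and would miss u,
    against connectedness. *)
Lemma cut_reach S u a : S \in same_nbr_cuts G -> u \in S -> a \notin S ->
  exists z, [/\ edge u z, z \notin S & connect (del_edge S) a z].
Proof.
move=> SQ uS aS; pose C := [set z | (z \notin S) && connect (del_edge S) a z].
case: (boolP [exists z in C, edge u z]) => [/exists_inP[z]|].
  by rewrite inE => /andP[? ?] ?; exists z.
move/exists_inPn => nC; have Csym := sym_connect_sym (@edge_sym G).
have cl : closed (@edge G) C.
  apply: intro_closed => // b c bc bC; rewrite inE.
  have := nC b bC; move: bC; rewrite inE => /andP[bS ab].
  case: (boolP (c \in S)) => [cS|cS _] /=.
    by rewrite (cut_twins SQ uS cS bS) edge_sym bc.
  by apply: connect_trans ab (connect1 _); apply/and3P.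
have := closed_connect cl (Gconn a u); rewrite !inE aS uS connect0 //.
Qed.

(* If S and S' shared u, say S' = {u, w}, then every component of G \ S would
   contain w, as it contains a neighbour of u. *)
Lemma cuts_disjoint S S' u : S \in same_nbr_cuts G -> S' \in same_nbr_cuts G ->
  u \in S -> u \in S' -> S = S'.
Proof.
move=> SQ SQ' uS uS'; apply/eqP/negPn/negP => nSS'.
have [w uw ES'] := cut_other SQ' uS'.
have wS : w \notin S.
  apply: contra nSS' => wS; apply/eqP; rewrite ES'; exact: cut_pair.
have toW a : a \notin S -> connect (del_edge S) a w.
  move=> aS; have [z [uz zS az]] := cut_reach SQ uS aS.
  have [<- //|zw] := eqVneq z w.
  apply: connect_trans az (connect1 _); apply/and3P; split=> //.
  rewrite edge_sym -(cut_twins SQ' uS' (_ : w \in S')) // ES' !inE ?eqxx ?orbT //.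
  by rewrite (negPf zw) orbF; apply: contraNneq zS => ->.
have [a [b [aS bS /negP[]]]] := cut_disconnected SQ.
by apply: connect_trans (toW a aS) _; rewrite del_edge_connect_sym toW.
Qed.

Lemma cuts_mem S S' u : S \in same_nbr_cuts G -> S' \in same_nbr_cuts G ->
  S != S' -> u \in S' -> u \notin S.
Proof.
by move=> SQ SQ' nSS' uS'; apply: contra nSS' => uS; apply/eqP/cuts_disjoint/uS'.
Qed.

(** A neighbour z of a outside S is either b itself or, lying outside S', a neighbour of the twin b
    as well; both cases connect a to b in G \ S. *)
Lemma split_cut_nbr S S' a b z :
  S \in same_nbr_cuts G -> S' \in same_nbr_cuts G -> S != S' ->
  a \in S' -> b \in S' -> ~~ connect (del_edge S) a b ->
  edge a z -> z \in S.
Proof.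
move=> SQ SQ' nSS' aS bS nab az; apply: contraNT nab => zS.
have aNS := cuts_mem SQ SQ' nSS' aS; have bNS := cuts_mem SQ SQ' nSS' bS.
have az1 : connect (del_edge S) a z by apply/connect1/and3P.
have [<- //|zb] := eqVneq z b.
have za : z != a by apply: contraTneq az => ->; rewrite edge_irr.
apply: connect_trans az1 (connect1 _); apply/and3P; split=> //.
have [->|ab] := eqVneq b a; first by rewrite edge_sym.
rewrite edge_sym -(cut_twins SQ' aS bS) // (cut_pair SQ' bS aS ab) !inE.
by rewrite negb_or zb.
Qed.

(** Every component of G \ S' contains a neighbour of a, and these all lie in S = {u, v}. If u and v
    were connected in G \ S', this graph would be connected. *)
Lemma split_cut_sym S S' a b u v :
  S \in same_nbr_cuts G -> S' \in same_nbr_cuts G -> S != S' ->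
  a \in S' -> b \in S' -> ~~ connect (del_edge S) a b ->
  u \in S -> v \in S -> u != v -> ~~ connect (del_edge S') u v.
Proof.
move=> SQ SQ' nSS' aS bS nab uS vS uv; apply/negP => cuv.
have ES := cut_pair SQ uS vS uv.
have toU c : c \notin S' -> connect (del_edge S') c u.
  move=> cS; have [z [az zS cz]] := cut_reach SQ' aS cS.
  have := split_cut_nbr SQ SQ' nSS' aS bS nab az.
  rewrite ES => /set2P[] E; first by rewrite -E.
  by apply: connect_trans cz _; rewrite E del_edge_connect_sym.
have [c [d [cS dS /negP[]]]] := cut_disconnected SQ'.
by apply: connect_trans (toU c cS) _; rewrite del_edge_connect_sym toU.
Qed.

(** Separation is mutual, so each of the four vertices has all its neighbours in the other cut.
    Hence the union of the cuts is closed under adjacency and is the whole graph, and twinness makes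
    every pair across the two cuts an edge. *)
Lemma split_cut_cycle4 S S' a b :
  S \in same_nbr_cuts G -> S' \in same_nbr_cuts G -> S != S' ->
  a \in S' -> b \in S' -> ~~ connect (del_edge S) a b ->
  S :|: S' = setT /\ is_cycle4 G.
Proof.
move=> SQ SQ' nSS' aS bS nab; have nS'S : S' != S by rewrite eq_sym.
have ab : a != b by apply: contraNneq nab => ->.
have nba : ~~ connect (del_edge S) b a by rewrite del_edge_connect_sym.
have [u uS] : exists u, u \in S.
  by apply/card_gt0P; rewrite (card_same_nbr_cuts SQ).
have [v uv ES] := cut_other SQ uS.
have vS : v \in S by rewrite ES !inE eqxx orbT.
have ES' := cut_pair SQ' aS bS ab.
have nuv := split_cut_sym SQ SQ' nSS' aS bS nab uS vS uv.
have nvu : ~~ connect (del_edge S') v u by rewrite del_edge_connect_sym.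
have Na := split_cut_nbr SQ SQ' nSS' aS bS nab.
have Nb := split_cut_nbr SQ SQ' nSS' bS aS nba.
have Nu := split_cut_nbr SQ' SQ nS'S uS vS nuv.
have Nv := split_cut_nbr SQ' SQ nS'S vS uS nvu.
have VT : S :|: S' = setT.
  apply/setP => z; rewrite in_setT -(closed_connect _ (Gconn a z)) ?inE ?aS ?orbT //.
  apply: intro_closed; first exact: sym_connect_sym (@edge_sym G).
  move=> c d cd; rewrite ES ES' !inE -!orbA => /or4P[]/eqP E.
  - by move: cd; rewrite E => /Nu; rewrite ES' !inE => /orP[]->; rewrite ?orbT.
  - by move: cd; rewrite E => /Nv; rewrite ES' !inE => /orP[]->; rewrite ?orbT.
  - by move: cd; rewrite E => /Na; rewrite ES !inE => /orP[]->; rewrite ?orbT.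
  - by move: cd; rewrite E => /Nb; rewrite ES !inE => /orP[]->; rewrite ?orbT.
split=> //.
have uS' := cuts_mem SQ' SQ nS'S uS; have vS' := cuts_mem SQ' SQ nS'S vS.
have aNS := cuts_mem SQ SQ' nSS' aS; have bNS := cuts_mem SQ SQ' nSS' bS.
have ua : edge u a.
  have [z [uz zS _]] := cut_reach SQ uS aNS; have := Nu _ uz.
  rewrite ES' => /set2P[<- //|E]; rewrite edge_sym (cut_twins SQ' aS bS) //.
  by rewrite edge_sym -E.
have va : edge v a by rewrite (cut_twins SQ vS uS).
have ub : edge u b by rewrite edge_sym (cut_twins SQ' bS aS) // edge_sym.
have vb : edge v b by rewrite (cut_twins SQ vS uS).
have Euv : edge u v = false by apply: contraNF vS' => /Nu.
have Eab : edge a b = false by apply: contraNF bNS => /Na.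
(* The cycle alternates between S = {u, v} and S' = {a, b}. *)
pose f (i : 'I_4) := nth u [:: u; a; v; b] i.
have un : uniq [:: u; a; v; b].
  rewrite /= !inE !negb_or uv ab andbT.
  have ne (c d : G) : edge c d -> c != d.
    by move=> cd; apply: contraTneq cd => ->; rewrite edge_irr.
  by rewrite (ne _ _ ua) (ne _ _ ub) (ne _ _ vb) (eq_sym a) (ne _ _ va).
exists f.
  apply: inj_card_bij; first by move=> i j /eqP; rewrite nth_uniq // => /eqP/val_inj.
  by rewrite card_ord -cardsT -VT (leq_trans (leq_card_setU _ _)) //
     (card_same_nbr_cuts SQ) (card_same_nbr_cuts SQ').
have E := (edge_irr, ua, va, ub, vb, Euv, Eab, etrans (edge_sym a u) ua,
  etrans (edge_sym a v) va, etrans (edge_sym b u) ub, etrans (edge_sym b v) vb,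
  etrans (edge_sym v u) Euv, etrans (edge_sym b a) Eab).
by case=> [[|[|[|[|//]]]] ?] [[|[|[|[|//]]]] ?]; rewrite /f /= E.
Qed.
End Cuts.

(** * Traces and sizes of finite sets *)

Lemma card_setI_pair (T : finType) (A : {set T}) a b : a != b ->
  #|A :&: [set a; b]| = (a \in A) + (b \in A).
Proof.
move=> ab; rewrite (cardsD1 a) (cardsD1 b) !inE !eqxx orbT !andbT eq_sym ab /=.
rewrite [X in _ + (_ + X)](_ : _ = 0) ?addn0 //; apply/eqP; rewrite cards_eq0.
by apply/eqP/setP => z; rewrite !inE; case: eqP; case: eqP; rewrite ?andbF.
Qed.

Lemma mem_imset_perm (T : finType) (f : {perm T}) (A : {set T}) z :
  (z \in f @: A) = (f^-1 z \in A).
Proof. by rewrite -{1}(permKV f z) (mem_imset _ _ (@perm_inj _ f)). Qed.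

(** A transposition changes A only if A contains exactly one of the two points, and then it toggles
    both. Writing this as an exclusive or lets later set equalities be computed modulo 2. *)
Lemma mem_imset_tperm (T : finType) (A : {set T}) (a b z : T) : a != b ->
  (z \in tperm a b @: A) =
  (z \in A) (+) ((#|A :&: [set a; b]| == 1%N) && (z \in [set a; b])).
Proof.
move=> ab; rewrite card_setI_pair // mem_imset_perm tpermV !inE.
case: tpermP => [->|->|/eqP/negPf-> /eqP/negPf->];
  by rewrite ?eqxx ?orbT ?andbF ?addbF //; case: (a \in A); case: (b \in A).
Qed.

Lemma subset_of_size (T : finType) (B D : {set T}) n : B \subset D ->
  #|B| <= n <= #|D| ->
  exists A : {set T}, [/\ B \subset A, A \subset D & #|A| = n].
Proof.
move=> BD /andP[Bn nD]; pose R := [set z in take (n - #|B|) (enum (D :\: B))].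
have RD : R \subset D :\: B.
  by apply/subsetP => z; rewrite inE => /mem_take; rewrite mem_enum.
have cR : #|R| = n - #|B|.
  rewrite cardsE (card_uniqP _) ?take_uniq ?enum_uniq // size_takel //.
  by rewrite -cardE cardsD (setIidPr BD) leq_sub2r.
exists (B :|: R); split; first exact: subsetUl.
  by rewrite subUset BD (subset_trans RD) // subsetDl.
rewrite cardsU cR (_ : B :&: R = set0) ?cards0 ?subn0 ?subnKC //.
apply/eqP; rewrite setI_eq0 disjoint_sym.
by apply: disjointWl RD _; rewrite disjoints_subset subsetDr.
Qed.

Lemma card_components (G : sgraph) (S A : {set G}) :
  #|A| = #|A :&: S| + \sum_(C in components S) #|A :&: C|.
Proof.
have card_sum (B : {set G}) : #|A :&: B| = \sum_(z in B) (z \in A).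
  rewrite -sum1_card big_mkcond [RHS]big_mkcond; apply: eq_bigr => z _.
  by rewrite inE; case: (z \in A); case: (z \in B).
rewrite (eq_bigr _ (fun C _ => card_sum C)).
rewrite -(set_partition_big _ (components_partition S)) -card_sum.
by rewrite setIC -setDE addnC; have := cardsID S A; rewrite addnC setIC.
Qed.

(** * Exchanges of twins in token sets *)

Section Swaps.
Variables (G : sgraph) (k : nat) (x y : {set G} -> G).
Hypothesis Gconn : connected_graph G.
Hypothesis hk : 0 < k < #|G|.
Hypothesis hC4 : ~ (k = 2 /\ is_cycle4 G).
Hypothesis hxy : forall S, S \in same_nbr_cuts G -> S = [set x S; y S].

Implicit Types (p q : TG G k) (A B : token_vertex G k) (S C : {set G}).

Definition cut_of p : {set G} := (val p).1.

Definition has_type p (A : {set G}) : bool :=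
  [forall C in components (cut_of p), #|A :&: C| == (val p).2 C :> nat].

Lemma has_typeP p (A : {set G}) :
  reflect (forall C, C \in components (cut_of p) -> #|A :&: C| = (val p).2 C)
          (has_type p A).
Proof.
apply: (iffP forall_inP) => H C /H; first by move/eqP.
by move=> ->.
Qed.

Lemma cut_of_cut p : cut_of p \in same_nbr_cuts G.
Proof. by case/andP: (valP p). Qed.

Lemma label_neq S : S \in same_nbr_cuts G -> x S != y S.
Proof.
move=> SQ; have := card_same_nbr_cuts SQ.
by rewrite {1}(hxy SQ) cards2; case: (x S == y S).
Qed.

Lemma has_type_inj p q (A : {set G}) : cut_of p = cut_of q ->
  has_type p A -> has_type q A -> p = q.
Proof.
case: p q => [[S t] Pp] [[S' t'] Pq]; rewrite /cut_of /= => SS'; subst S'.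
move=> /has_typeP tA /has_typeP tA'; apply: val_inj; congr (_, _) => /=.
have /andP[_ /TS_P[_ t0 _]] := Pp; have /andP[_ /TS_P[_ t0' _]] := Pq.
apply/ffunP => C; have [CS|nCS] := boolP (C \in components S).
  by apply: val_inj; rewrite /= -(tA C CS) -(tA' C CS).
by rewrite t0 // t0'.
Qed.

(** The components carry k - 1 of the k tokens, which leaves one for the cut. *)
Lemma has_type_card p A : has_type p (val A) -> #|val A :&: cut_of p| = 1%N.
Proof.
move=> /has_typeP tA; have /andP[_ /TS_P[_ _ t_sum]] := valP p.
have := card_components (cut_of p) (val A).
rewrite (eqP (valP A)) (eq_bigr _ tA) t_sum => E.
by apply: (@addIn k.-1); rewrite -E add1n prednK //; case/andP: hk.
Qed.

(** Distinct cuts are disjoint, so z determines the cut, and then A determines the tuple. *)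
Lemma has_type_eq p A z q : has_type p (val A) -> has_type q (val A) ->
  z \in cut_of p -> z \in cut_of q -> p = q.
Proof.
move=> tp tq zp zq; apply: has_type_inj tp tq.
exact: cuts_disjoint (cut_of_cut p) (cut_of_cut q) zp zq.
Qed.

Definition cut_swap S : {perm G} := tperm (x S) (y S).

Definition tau_fun p A : token_vertex G k :=
  if has_type p (val A) then iota_fun (cut_swap (cut_of p)) A else A.

Lemma mem_tau_fun p A z :
  (z \in val (tau_fun p A)) =
  (z \in val A) (+) (has_type p (val A) && (z \in cut_of p)).
Proof.
rewrite /tau_fun; case: ifP => tA; last by rewrite addbF.
have SQ := cut_of_cut p; rewrite /= mem_imset_tperm ?label_neq //.
by rewrite -(hxy SQ) has_type_card.
Qed.

(* When both cuts carry exactly one token of A, neither separates the other. *)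
Lemma unsplit_cuts S S' A : S \in same_nbr_cuts G -> S' \in same_nbr_cuts G ->
  S != S' -> #|val A :&: S| = 1%N -> #|val A :&: S'| = 1%N ->
  forall a b, a \in S' -> b \in S' -> connect (del_edge S) a b.
Proof.
move=> SQ SQ' nSS' AS AS' a b aS bS; apply/negPn/negP => nab; apply: hC4.
have [VT ?] := split_cut_cycle4 Gconn SQ SQ' nSS' aS bS nab; split=> //.
rewrite -(eqP (valP A)) -[val A]setIT -VT setIUr cardsU AS AS'.
suff -> : val A :&: S :&: (val A :&: S') = set0 by rewrite cards0.
apply/setP => z; rewrite !inE; apply/negP => /andP[/andP[_ zS] /andP[_ zS']].
by case/negP: (cuts_mem Gconn SQ SQ' nSS' zS').
Qed.

(** If p and q have the same cut, [tau_fun p] alters A only on that cut, away from all components.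
    If the cuts differ, both exchanged vertices lie in one component of the graph without the cut of
    q, so every count of q is kept. *)
Lemma has_type_tau_imp p q A :
  has_type q (val A) -> has_type q (val (tau_fun p A)).
Proof.
move=> tq; have [tp|/negbTE tp] := boolP (has_type p (val A)); last first.
  by rewrite /tau_fun tp.
have Sp := cut_of_cut p; have Sq := cut_of_cut q.
apply/has_typeP => C CS; rewrite -(has_typeP _ _ tq C CS).
have [E|nE] := eqVneq (cut_of q) (cut_of p).
  congr #|pred_of_set _|; apply/setP => z; rewrite !inE mem_tau_fun tp /=.
  have [zC|] := boolP (z \in C); last by rewrite !andbF.
  by rewrite -E (negPf (component_notin CS zC)) addbF.
have px : x (cut_of p) \in cut_of p by rewrite {2}(hxy Sp) !inE eqxx.
have py : y (cut_of p) \in cut_of p by rewrite {2}(hxy Sp) !inE eqxx orbT.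
have cxy := unsplit_cuts Sq Sp nE (has_type_card tq) (has_type_card tp).
have CE : (x (cut_of p) \in C) = (y (cut_of p) \in C).
  have imp a b : a \in cut_of p -> b \in cut_of p -> a \in C -> b \in C.
    move=> aS bS aC; rewrite (component_connect _ CS aC) cxy //.
    by rewrite (cuts_mem Gconn Sq Sp nE bS).
  by apply/idP/idP; apply: imp.
rewrite /tau_fun tp /=.
rewrite -(card_imset (val A :&: C) (@perm_inj _ (cut_swap (cut_of p)))).
congr #|pred_of_set _|; apply/setP => z.
rewrite !inE !mem_imset_perm inE; congr (_ && _).
by rewrite tpermV; case: tpermP => // ->.
Qed.

Lemma tau_funK p : involutive (tau_fun p).
Proof.
move=> A; apply/val_inj/setP => z; rewrite !mem_tau_fun.
have [tp|tp] := boolP (has_type p (val A)).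
  by rewrite has_type_tau_imp // addbK.
by rewrite /tau_fun (negPf tp) (negPf tp) !addbF.
Qed.

Lemma has_type_tau p q A :
  has_type q (val (tau_fun p A)) = has_type q (val A).
Proof.
apply/idP/idP; last exact: has_type_tau_imp.
by move/(@has_type_tau_imp p); rewrite tau_funK.
Qed.

Definition tau p : {perm token_vertex G k} := perm (can_inj (tau_funK p)).

Lemma in_symdiff (A B : {set G}) z :
  (z \in symdiff A B) = (z \in A) (+) (z \in B).
Proof. by rewrite !inE; case: (z \in A); case: (z \in B). Qed.

Lemma token_edgeC : symmetric (@token_edge G k).
Proof.
by move=> A B; rewrite /token_edge /symdiff; under eq_existsb => u do
  under eq_existsb => v do rewrite setUC.
Qed.

Lemma eq_card_trace A B (D : {set G}) u v : symdiff (val A) (val B) = [set u; v] ->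
  (u \in D) = (v \in D) -> #|val A :&: D| = #|val B :&: D|.
Proof.
move=> /setP AB; have memAB z : (z \in val A) = (z \in val B) (+) (z \in [set u; v]).
  by rewrite -AB in_symdiff addbA addbAC addbb.
have trace (E : {set G}) : u \notin E -> v \notin E -> val A :&: E = val B :&: E.
  move=> uE vE; apply/setP => z; rewrite !in_setI memAB.
  have [zE|] := boolP (z \in E); last by rewrite !andbF.
  rewrite !inE (negPf (contraNneq _ uE)) ?(negPf (contraNneq _ vE)) ?addbF //;
    by move=> <-.
(* When u and v both lie in D, the traces on the complement of D agree, and A and B have the same
   size. *)
have [uD /esym vD|uD /esym/negbT vD] := boolP (u \in D); last by rewrite trace.
have E : val A :\: D = val B :\: D by rewrite !setDE trace // inE ?uD ?vD.
apply: (@addIn #|val A :\: D|); rewrite cardsID E cardsID.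
by rewrite (eqP (valP A)) (eqP (valP B)).
Qed.

(** If neither u nor v is in the cut, adjacency puts them in the same component; if both are, no
    component contains them. Either way moving a token between them changes no count. *)
Lemma has_type_edge p A B u v : edge u v ->
  symdiff (val A) (val B) = [set u; v] ->
  (u \in cut_of p) = (v \in cut_of p) ->
  has_type p (val A) = has_type p (val B).
Proof.
move=> uv AB uvS; apply: eq_forallb_in => C CS.
rewrite (eq_card_trace AB) //.
have imp a b : edge a b -> (a \in cut_of p) = (b \in cut_of p) ->
    a \in C -> b \in C.
  move=> ab abS aC; have aS := component_notin CS aC.
  rewrite (component_connect _ CS aC) -abS aS connect1 //.
  by apply/and3P; rewrite -abS.
by apply/idP/idP; apply: imp; rewrite // edge_sym.
Qed.

(** If A and B agree on having type p, both are toggled on the same set and their symmetric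
    difference {u, v} is unchanged. Otherwise exactly one of u and v, say u, is in the cut, and the
    toggle replaces u by its twin w: the symmetric difference becomes {w, v}, again an edge. *)
Lemma token_edge_tau p A B :
  token_edge A B -> token_edge (tau_fun p A) (tau_fun p B).
Proof.
(* By symmetry of adjacency, if only one of the two sets has type p, it is A. *)
wlog ltAB : A B / has_type p (val B) -> has_type p (val A) => [IH|].
  have [tA|tA] := boolP (has_type p (val A)); first exact: IH.
  rewrite token_edgeC (token_edgeC (tau_fun p A)); apply: IH.
  by rewrite (negPf tA).
case/existsP=> u /existsP[v /andP[uv /eqP AB]].
have [tAB|] := eqVneq (has_type p (val A)) (has_type p (val B)).
  apply/existsP; exists u; apply/existsP; exists v; rewrite uv -AB.
  apply/eqP/setP => z; rewrite !in_symdiff !mem_tau_fun tAB.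
  by rewrite addbACA addbb addbF.
move=> tAB; have uvS : (u \in cut_of p) != (v \in cut_of p).
  by apply: contra tAB => /eqP; move/(has_type_edge uv AB)->.
have {ltAB} [tA /negbTE tB] : has_type p (val A) /\ ~~ has_type p (val B).
  by move: tAB ltAB; do 2!case: has_type => //; move=> _ /(_ isT).
wlog uS : u v uv AB uvS / u \in cut_of p => [IH|].
  have [uS|uS] := boolP (u \in cut_of p); first exact: IH uv AB uvS uS.
  apply: (IH v u); rewrite 1?edge_sym 1?setUC 1?eq_sym //.
  by move: uvS; rewrite (negPf uS); case: (v \in _).
have vS : v \notin cut_of p by move: uvS; rewrite uS; case: (v \in _).
have [w uw SE] := cut_other (cut_of_cut p) uS.
have wS : w \in cut_of p by rewrite SE !inE eqxx orbT.
apply/existsP; exists w; apply/existsP; exists v.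
rewrite -(cut_twins (cut_of_cut p) uS wS vS) uv /=; apply/eqP/setP => z.
rewrite in_symdiff !mem_tau_fun tA tB /= addbF addbAC -in_symdiff AB SE.
rewrite !inE; have [->|zu] := eqVneq z u.
  by rewrite (negPf uw) /=; apply/esym/negbTE; apply: contraNneq vS => <-.
have [->|zw] := eqVneq z w => /=; last by rewrite addbF.
by rewrite addbT; apply: contraNneq vS => <-.
Qed.

Lemma tau_aut p : tau p \in aut_rel (@token_edge G k).
Proof.
apply/aut_relP => A B; rewrite !permE; apply/idP/idP; last exact: token_edge_tau.
by move/(@token_edge_tau p); rewrite !tau_funK.
Qed.

(** * Composites of exchanges and the base group *)

Definition swaps (r : seq (TG G k)) : {perm token_vertex G k} :=
  \prod_(p <- r) tau p.

Lemma swaps_aut r : swaps r \in aut_rel (@token_edge G k).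
Proof. by apply: group_prod => p _; apply: tau_aut. Qed.

Lemma has_type_swaps r q A : has_type q (val (swaps r A)) = has_type q (val A).
Proof.
rewrite /swaps; elim: r A => [|p r IH] A; first by rewrite big_nil perm1.
by rewrite big_cons permM IH permE has_type_tau.
Qed.

(** The factors preserve all types, so each toggles according to the type of the original A. By
    [has_type_eq] at most one factor affects z, so the successive toggles never cancel. *)
Lemma mem_swaps r A z : uniq r ->
  (z \in val (swaps r A)) =
  (z \in val A) (+) has (fun p => has_type p (val A) && (z \in cut_of p)) r.
Proof.
rewrite /swaps; elim: r A => [|p r IH] A /=.
  by rewrite big_nil perm1 addbF.
case/andP=> pr ur; rewrite big_cons permM IH // permE mem_tau_fun -addbA.
congr (_ (+) _); under eq_has => q do rewrite has_type_tau.
case: andP => //= -[tp zp]; apply/hasPn => q qr; apply: contra pr => /andP[tq zq].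
by rewrite (has_type_eq tp tq zp zq).
Qed.

(** In particular the order of the factors is immaterial: the exchanges commute. *)
Lemma eq_swaps r s : uniq r -> uniq s -> r =i s -> swaps r = swaps s.
Proof.
move=> ur us rs; apply/permP => A; apply/val_inj/setP => z.
by rewrite !mem_swaps // (eq_has_r rs).
Qed.

Local Notation base := {dffun forall _ : TG G k, 'Z_2}.

Definition supp (v : base) := [seq p <- enum {: TG G k} | v p != 0%R].

Lemma mem_supp v p : (p \in supp v) = (v p != 0%R).
Proof. by rewrite mem_filter mem_enum andbT. Qed.

Lemma supp_uniq v : uniq (supp v).
Proof. by rewrite filter_uniq // enum_uniq. Qed.

Definition swap_of (v : base) := swaps (supp v).

Lemma mem_swap_of (v : base) A z p : has_type p (val A) -> z \in cut_of p ->
  (z \in val (swap_of v A)) = (z \in val A) (+) (v p != 0%R).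
Proof.
move=> tp zp; rewrite mem_swaps ?supp_uniq //; congr (_ (+) _).
apply/hasP/idP => [[q]|vp]; last by exists p; rewrite ?mem_supp ?tp.
by rewrite mem_supp => vq /andP[tq zq]; rewrite (has_type_eq tp tq zp zq).
Qed.

Lemma mem_swap_of_id (v : base) A z :
  ~~ [exists p, has_type p (val A) && (z \in cut_of p)] ->
  (z \in val (swap_of v A)) = (z \in val A).
Proof.
move/existsPn=> nA; rewrite mem_swaps ?supp_uniq // -[RHS]addbF; congr (_ (+) _).
by apply/hasPn => q _.
Qed.

(** At a vertex z governed by p, each factor toggles according to its own coordinate at p, and two
    toggles add up in Z_2. *)
Lemma swap_ofM : {morph swap_of : u v / u * v}.
Proof.
move=> u v; apply/permP => A; apply/val_inj/setP => z; rewrite permM.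
have [/existsP[p /andP[tp zp]]|nA] :=
  boolP [exists p, has_type p (val A) && (z \in cut_of p)].
  rewrite !(mem_swap_of _ _ zp) ?has_type_swaps // -addbA ffunE.
  by congr (_ (+) _); case: (u p) (v p) => [[|[|//]] ?] [[|[|//]] ?].
rewrite !mem_swap_of_id //.
by under eq_existsb => p do rewrite has_type_swaps.
Qed.
(* Stated over [base] itself, the morphism below is found only after a very slow
   comparison of two instances of the finite type structure of [base]. *)
Definition wbase : finGroupType := base.
Lemma swap_of_morphic :
  {in [set: wbase] &, {morph (swap_of : wbase -> _) : u v / u * v}}.
Proof. by move=> u v _ _; exact: swap_ofM. Qed.
Canonical swap_of_morphism := Morphism swap_of_morphic.

(** One token goes to the labelled vertex of the cut and the prescribed number to each component, 1
    + (k - 1) = k in all. The resulting set detects the coordinate at p, which gives injectivity on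
    the base group. *)
Lemma has_type_exists p : exists A, has_type p (val A).
Proof.
have Sp := cut_of_cut p; have /andP[_ /TS_P[t_le _ t_sum]] := valP p.
rewrite -/(cut_of p) in t_le t_sum Sp; set S := cut_of p in t_le t_sum Sp *.
set t := (val p).2 in t_le t_sum.
have xS : x S \in S by rewrite {2}(hxy Sp) !inE eqxx.
pose A0 := [set z | (z == x S) ||
  [exists C in components S, z \in take (t C) (enum C)]].
have A0C C : C \in components S -> #|A0 :&: C| = t C.
  move=> CS; have -> : A0 :&: C = [set z in take (t C) (enum C)].
    apply/setP => z; rewrite !inE; apply/andP/idP => [[/orP[/eqP->|]]|tz].
    - by move/(component_notin CS); rewrite xS.
    - case/exists_inP=> C' CS' tz zC; have := mem_take tz; rewrite mem_enum => zC'.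
      by rewrite (components_eq CS CS' zC zC').
    - split; last by have := mem_take tz; rewrite mem_enum.
      by apply/orP; right; apply/exists_inP; exists C.
  rewrite cardsE (card_uniqP _) ?take_uniq ?enum_uniq // size_takel //.
  by rewrite -cardE t_le.
have A0S : A0 :&: S = [set x S].
  apply/setP => z; rewrite !inE; apply/andP/idP => [[/orP[//|]]|/eqP->].
    case/exists_inP=> C CS /mem_take; rewrite mem_enum.
    by move/(component_notin CS)/negPf->.
  by rewrite eqxx xS.
have cA0 : #|A0| == k.
  rewrite (card_components S) A0S cards1 (eq_bigr _ A0C) t_sum add1n prednK //.
  by case/andP: hk.
by exists (Sub A0 cA0); apply/has_typeP => C CS; rewrite SubK A0C.
Qed.

Lemma type_exists S A : S \in same_nbr_cuts G -> #|val A :&: S| = 1%N ->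
  exists2 p, cut_of p = S & has_type p (val A).
Proof.
move=> SQ AS; pose t : tuples G := [ffun C : {set G} =>
  if C \in components S then inord #|val A :&: C| else ord0].
have tE C : C \in components S -> t C = #|val A :&: C| :> nat.
  by move=> CS; rewrite ffunE CS inordK // ltnS max_card.
have tS : t \in TS k S.
  apply/TS_P; split=> [C CS|C nCS|].
  - by rewrite tE // subset_leq_card // subsetIr.
  - by rewrite ffunE (negPf nCS).
  - rewrite (eq_bigr _ tE) -[in RHS](eqP (valP A)) (card_components S) AS.
    by rewrite add1n.
have pP : ((S, t).1 \in same_nbr_cuts G) && ((S, t).2 \in TS k (S, t).1).
  by rewrite SQ.
exists (Sub (S, t) pP); first by rewrite /cut_of SubK.
by apply/has_typeP => C; rewrite /cut_of SubK => CS; rewrite tE.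
Qed.

Lemma injm_swap_of : 'injm swap_of_morphism.
Proof.
apply/injmP => u v _ _ uv; apply/ffunP => p.
have [A tA] := has_type_exists p.
have xS : x (cut_of p) \in cut_of p by rewrite {2}(hxy (cut_of_cut p)) !inE eqxx.
have := congr1 (fun g : {perm _} => x (cut_of p) \in val (g A)) uv.
rewrite /= !(mem_swap_of _ tA xS) => /addbI.
by case: (u p) (v p) => [[|[|//]] ?] [[|[|//]] ?] // _; apply: val_inj.
Qed.

(** This is the obstruction used to tell composites of exchanges from other automorphisms: a vertex
    can change only together with a whole cut that carries exactly one token. *)
Lemma swap_of_flip (v : base) A z :
  (z \in val (swap_of v A)) != (z \in val A) ->
  exists S, [/\ S \in same_nbr_cuts G, z \in S, #|val A :&: S| = 1%N &
    forall w, w \in S -> (w \in val (swap_of v A)) = (w \notin val A)].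
Proof.
have [/existsP[p /andP[tp zp]]|nA] :=
  boolP [exists p, has_type p (val A) && (z \in cut_of p)]; last first.
  by rewrite mem_swap_of_id // eqxx.
rewrite (mem_swap_of v tp zp).
have [_|vp _] := eqVneq (v p) 0%R; first by rewrite addbF eqxx.
exists (cut_of p); split; rewrite ?cut_of_cut ?has_type_card // => w wp.
by rewrite (mem_swap_of v tp wp) vp addbT.
Qed.

(** * Conjugation of exchanges and induced automorphisms *)

Lemma tau_conj (h : {perm token_vertex G k}) p q :
  (forall A, h (tau_fun p A) = tau_fun q (h A)) -> tau p ^ h = tau q.
Proof.
move=> H; apply/permP => B; rewrite -(permKV h B) permJ !permE.
by rewrite H.
Qed.

Lemma swap_of_conj (aT : finGroupType) (K : {group aT}) (to : action K (TG G k))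
    (v : base) a (h : {perm token_vertex G k}) : a \in K ->
  (forall p, tau p ^ h = tau (to p a)) ->
  swap_of v ^ h = swap_of (wr_act to v a).
Proof.
move=> Ka H; rewrite /swap_of; transitivity (swaps [seq to p a | p <- supp v]).
  rewrite /swaps big_map
    (big_morph (conjg^~ h) (fun u w => conjMg u w h) (conj1g h)).
  by apply: eq_bigr => p _; rewrite H.
(* Moving the support by a gives the support of the vector moved by a; the order of its elements may
   differ. *)
apply: eq_swaps; rewrite ?supp_uniq ?map_inj_uniq ?supp_uniq //; try exact: act_inj.
move=> p; rewrite mem_supp ffunE -[p in LHS](actKVin to Ka).
by have /= -> := mem_map (act_inj to a) (supp v) (to p a^-1); rewrite mem_supp.
Qed.

Lemma cut_of_action p f : f \in 'Aut G ->
  cut_of (TG_action G k p f) = f @: cut_of p.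
Proof. by move=> fG; rewrite /cut_of val_TG_action. Qed.

Lemma has_type_action p f (A : {set G}) : f \in 'Aut G ->
  has_type (TG_action G k p f) (f @: A) = has_type p A.
Proof.
move=> fG; apply/has_typeP/has_typeP => tA C.
  move=> CS; have := tA (f @: C); rewrite cut_of_action // aut_component //.
  rewrite -imsetI; last by move=> ? ? _ _; apply: perm_inj.
  rewrite card_imset; last exact: perm_inj.
  by move->; rewrite // val_TG_action //= ffunE preim_imset_perm.
rewrite cut_of_action // -(imset_preim_perm f C) aut_component // => /tA.
rewrite -imsetI; last by move=> ? ? _ _; apply: perm_inj.
rewrite card_imset; last exact: perm_inj.
by move->; rewrite val_TG_action //= ffunE preim_imset_perm.
Qed.

Lemma tau_iota p f : f \in 'Aut G ->
  tau p ^ tok_iota k f = tau (TG_action G k p f).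
Proof.
move=> fG; apply: tau_conj => A; rewrite !permE.
apply/val_inj/setP => z; rewrite mem_tau_fun /= cut_of_action // has_type_action //.
by rewrite !mem_imset_perm mem_tau_fun.
Qed.

Lemma tok_iota_aut f : f \in 'Aut G -> tok_iota k f \in aut_rel (@token_edge G k).
Proof.
have imp (g : {perm G}) A B : g \in 'Aut G -> token_edge A B ->
    token_edge (iota_fun g A) (iota_fun g B).
  move=> gG /existsP[u /existsP[v /andP[uv /eqP AB]]].
  apply/existsP; exists (g u); apply/existsP; exists (g v).
  rewrite (aut_relP _ _ gG) uv; apply/eqP/setP => z.
  rewrite in_symdiff /= !mem_imset_perm -(in_symdiff (val A) (val B)) AB !inE.
  rewrite -[X in X == g u](permKV g) -[X in X == g v](permKV g).
  by rewrite !(inj_eq (@perm_inj _ g)).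
move=> fG; apply/aut_relP => A B; rewrite !permE.
apply/idP/idP; last exact: imp.
move/imp => /(_ f^-1); rewrite groupV => /(_ fG).
have K X : iota_fun f^-1 (iota_fun f X) = X :> token_vertex G k.
  by apply: val_inj; apply: imset_permV.
by rewrite !K.
Qed.

Lemma cut_swapE S S' : S \in same_nbr_cuts G -> S' \in same_nbr_cuts G ->
  cut_swap S @: S' = S'.
Proof.
move=> SQ SQ'; apply/setP => z; rewrite mem_imset_perm tpermV /cut_swap.
have [<-|nSS'] := eqVneq S S'.
  by case: tpermP => // ->; rewrite {2 4}(hxy SQ) !inE !eqxx ?orbT.
have xS : x S \notin S'.
  by rewrite (cuts_mem Gconn SQ' SQ) 1?eq_sym // {2}(hxy SQ) !inE eqxx.
have yS : y S \notin S'.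
  by rewrite (cuts_mem Gconn SQ' SQ) 1?eq_sym // {2}(hxy SQ) !inE eqxx orbT.
by case: tpermP => // ->; rewrite (negPf xS) (negPf yS).
Qed.

Lemma cut_swap_aut S : S \in same_nbr_cuts G -> cut_swap S \in 'Aut G.
Proof.
move=> SQ; have xS : x S \in S by rewrite {2}(hxy SQ) !inE eqxx.
have yS : y S \in S by rewrite {2}(hxy SQ) !inE eqxx orbT.
have tw z : z != x S -> z != y S -> edge (x S) z = edge (y S) z.
  by move=> zx zy; apply: (cut_twins SQ); rewrite // (hxy SQ) !inE negb_or zx.
apply/aut_relP => u v; rewrite /cut_swap.
case: tpermP => [->|->|/eqP ux /eqP uy]; case: tpermP => [->|->|/eqP vx /eqP vy] //;
  rewrite ?edge_irr //; first by rewrite edge_sym.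
- by rewrite tw.
- by rewrite edge_sym.
- by rewrite tw.
- by rewrite edge_sym -tw // edge_sym.
- by rewrite edge_sym tw // edge_sym.
Qed.

Definition cut_indicator S : base := [ffun p => if cut_of p == S then 1%R else 0%R].

(** Exchanging the two vertices of S changes A only if A has exactly one token on S. Then A has a
    type at S, and the corresponding factor performs the same exchange. *)
Lemma tok_iota_cut_swap S : S \in same_nbr_cuts G ->
  tok_iota k (cut_swap S) = swap_of (cut_indicator S).
Proof.
move=> SQ; apply/permP => A; apply/val_inj/setP => z; rewrite permE /=.
rewrite mem_imset_tperm ?label_neq // -(hxy SQ).
have [/existsP[p /andP[tp zp]]|nA] :=
  boolP [exists p, has_type p (val A) && (z \in cut_of p)].
  rewrite (mem_swap_of _ tp zp) ffunE; congr (_ (+) _).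
  have [E|nE] := eqVneq (cut_of p) S; first by rewrite -E zp has_type_card.
  by rewrite (negPf (cuts_mem Gconn SQ (cut_of_cut p) _ zp)) ?andbF // eq_sym.
rewrite mem_swap_of_id //; case: eqP => [AS|] /=; last by rewrite addbF.
have [zS|] := boolP (z \in S); last by rewrite addbF.
have [p E tp] := type_exists SQ AS; case/negP: nA.
by apply/existsP; exists p; rewrite tp E.
Qed.

Lemma label_presP f : reflect
  (f \in 'Aut G /\ forall S, S \in same_nbr_cuts G -> f (x S) = x (f @: S))
  (f \in label_pres x).
Proof.
apply: (iffP setIdP) => -[fG H]; split=> //.
  by move=> S SQ; apply/eqP; apply: (forall_inP H).
by apply/forall_inP => S /H->.
Qed.

(* Composing f with the swap of a cut S corrects its effect on the label of S
   and on no other label. *)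
Lemma tok_iota_gen (H : {group {perm token_vertex G k}}) :
  (forall v : base, swap_of v \in H) -> iotaS k x \subset H ->
  tok_iota k @* 'Aut G \subset H.
Proof.
move=> vH SH; apply/subsetP => _ /morphimP[f _ fG ->] /=.
(* Induction on the number of cuts whose label f fails to preserve. *)
pose bad (f : {perm G}) := [set S in same_nbr_cuts G | f (x S) != x (f @: S)].
have [n] := ubnP #|bad f|; elim: n f fG => // n IH f fG lefn.
have [bad0|[S Sbad]] := set_0Vmem (bad f).
  apply: (subsetP SH); apply: mem_morphim => //; apply/label_presP; split=> // S SQ.
  apply/eqP; have := in_set0 S; rewrite -bad0 inE SQ /=.
  by move/negbT; rewrite negbK.
have [SQ fS] := setIdP Sbad; have sG := cut_swap_aut SQ.
have sSf S' : S' \in same_nbr_cuts G -> (cut_swap S * f) @: S' = f @: S'.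
  move=> SQ'; rewrite -{2}(cut_swapE SQ SQ') -imset_comp.
  by apply: eq_imset => z; rewrite /= permM.
have -> : f = cut_swap S * (cut_swap S * f) by rewrite mulgA tperm2 mul1g.
rewrite tok_iotaM ?groupM //; first by rewrite tok_iota_cut_swap ?vH.
apply: IH; rewrite ?groupM //; rewrite -ltnS (leq_trans _ lefn) // ltnS proper_card //.
apply/properP; split; last first.
  (* As f does not send [x S] to the label of the image cut, it sends [y S] there. *)
  exists S => //; rewrite inE SQ sSf //= permM tpermL negbK.
  have fSQ := same_nbr_cuts_aut fG SQ.
  have xS : x S \in S by rewrite {2}(hxy SQ) !inE eqxx.
  have yS : y S \in S by rewrite {2}(hxy SQ) !inE eqxx orbT.
  have := imset_f f xS; rewrite {1}(hxy fSQ) => /set2P[/eqP|fxS].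
    by rewrite (negPf fS).
  have := imset_f f yS; rewrite {1}(hxy fSQ) => /set2P[->//|].
  by rewrite -fxS => /perm_inj E; have := label_neq SQ; rewrite E eqxx.
apply/subsetP => S' /setIdP[SQ' bS']; rewrite inE SQ' /=.
apply: contra bS' => /eqP fS'; rewrite sSf // permM.
have [E|nE] := eqVneq S' S; first by rewrite -E fS' eqxx in fS.
have xS' : x S' \notin S.
  by apply: (cuts_mem Gconn SQ SQ'); rewrite 1?eq_sym // {2}(hxy SQ') !inE eqxx.
have -> : cut_swap S (x S') = x S'.
  move: xS'; rewrite {1}(hxy SQ) !inE negb_or => /andP[nx ny].
  by apply: tpermD; rewrite eq_sym.
by rewrite fS'.
Qed.

(** * Induced automorphisms that are composites of exchanges *)

Hypothesis hK2 : #|G| != 2.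

(* Otherwise take a token set A that omits u and contains f u together with its
   twin, if any: f u is not in f A, but no composite of swaps removes it.  This
   needs two tokens; for k = 1, A = {u} does. *)
Lemma swap_of_iota_moves (v : base) f u : tok_iota k f = swap_of v ->
  f u != u -> exists S, [/\ S \in same_nbr_cuts G, u \in S & f u \in S].
Proof.
move=> fv fu; have [k_gt0 k_lt] := andP hk.
have fA A : val (swap_of v A) = f @: val A by rewrite -fv permE.
have [k1|k_neq1] := eqVneq k 1%N.
  have cA : #|[set u]| == k by rewrite cards1 k1.
  have := @swap_of_flip v (Sub [set u] cA) (f u).
  rewrite fA SubK imset_set1 !inE eqxx (negPf fu) => /(_ isT)[S [SQ fS]].
  move=> AS _; exists S; split=> //; apply: contraTT isT => uS.
  suff E : [set u] :&: S = set0 by rewrite E cards0 in AS.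
  by apply/setP => z; rewrite !inE; case: eqP => // ->; rewrite (negPf uS).
have k_gt1 : 1 < k by rewrite ltn_neqAle eq_sym k_neq1.
have [S /and3P[SQ uS fS]|nS] :=
    pickP (fun S => [&& S \in same_nbr_cuts G, u \in S & f u \in S]).
  by exists S.
have [B [uB fB cB QB]] : exists B : {set G}, [/\ u \notin B, f u \in B, #|B| <= k &
    forall S, S \in same_nbr_cuts G -> f u \in S -> S \subset B].
  have [S /andP[SQ fS]|nSf] :=
      pickP (fun S => (S \in same_nbr_cuts G) && (f u \in S)).
    exists S; split=> // [||S' SQ' fS'].
    - by have := nS S; rewrite SQ fS andbT => /negbT.
    - by rewrite card_same_nbr_cuts.
    - by rewrite (cuts_disjoint Gconn SQ SQ' fS fS').
  exists [set f u]; split; rewrite ?inE ?cards1 // 1?eq_sym // => S SQ fS.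
  by have := nSf S; rewrite SQ fS.
have BD : B \subset [set~ u].
  by apply/subsetP => z zB; rewrite !inE; apply: contraNneq uB => <-.
have [|A [BA AD cA]] := @subset_of_size _ B [set~ u] k BD.
  by rewrite cB cardsC1 -ltnS prednK //; apply: leq_trans k_lt.
have cA' := introT eqP cA; have := @swap_of_flip v (Sub A cA') (f u).
have uA : u \notin A by apply/negP => /(subsetP AD); rewrite !inE eqxx.
rewrite fA SubK (mem_imset _ _ (@perm_inj _ f)) (negPf uA) (subsetP BA) //.
move=> /(_ isT)[S [SQ fS AS _]]; move: AS.
by rewrite (setIidPr (subset_trans (QB S SQ fS) BA)) card_same_nbr_cuts.
Qed.

(** If f moves u, then some cut contains u and f u, and some cut contains f u and f (f u). By
    disjointness they are the same cut, which f preserves as a set while moving both its vertices;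
    yet f must fix its label. *)
Lemma label_pres_swap_of (v : base) f : f \in label_pres x ->
  tok_iota k f = swap_of v -> f = 1.
Proof.
case/label_presP=> fG fx fv; apply/permP => u; rewrite perm1.
apply/eqP/negPn/negP => fu.
have [S [SQ uS fuS]] := swap_of_iota_moves fv fu.
have SE := cut_pair SQ uS fuS; rewrite eq_sym in fu; have {}SE := SE fu.
have ffu : f (f u) != f u by rewrite (inj_eq (@perm_inj _ f)) eq_sym.
have [S' [SQ' fuS' ffuS']] := swap_of_iota_moves fv ffu.
have E := cuts_disjoint Gconn SQ SQ' fuS fuS'; subst S'.
have fS : f @: S = S.
  apply/eqP; rewrite eqEcard card_imset ?leqnn ?andbT; last exact: perm_inj.
  by apply/subsetP => _ /imsetP[z zS ->]; move: zS; rewrite {1}SE => /set2P[]->.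
have xS : x S \in S by rewrite {2}(hxy SQ) !inE eqxx.
have := fx S SQ; rewrite fS => /eqP.
move: xS; rewrite {2}SE => /set2P[]->; apply/negP=> //; by rewrite eq_sym.
Qed.

(** * Complementation of token sets *)

Section Complement.
Hypothesis kG : k.*2 = #|G|.

Lemma tok_compl_proof A : #|~: val A| == k.
Proof.
by rewrite cardsCs setCK (eqP (valP A)) -kG -addnn addnK.
Qed.

Definition tok_compl_fun A : token_vertex G k := Sub (~: val A) (tok_compl_proof A).

Lemma tok_compl_funK : involutive tok_compl_fun.
Proof. by move=> A; apply: val_inj; rewrite /= setCK. Qed.

Definition tok_compl : {perm token_vertex G k} := perm (can_inj tok_compl_funK).

Lemma tok_compl2 : tok_compl * tok_compl = 1.
Proof. by apply/permP => A; rewrite permM perm1 !permE tok_compl_funK. Qed.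

Lemma tok_compl_aut : tok_compl \in aut_rel (@token_edge G k).
Proof.
apply/aut_relP => A B; rewrite !permE /token_edge /=.
suff -> : symdiff (~: val A) (~: val B) = symdiff (val A) (val B) by [].
by apply/setP => z; rewrite !in_symdiff !in_setC addNb addbN negbK.
Qed.

Lemma tok_compl_iota f : tok_compl * tok_iota k f = tok_iota k f * tok_compl.
Proof.
apply/permP => A; rewrite !permM !permE; apply/val_inj/setP => z.
by rewrite /= in_setC !mem_imset_perm in_setC.
Qed.

(** The complement of A meets a component C in |C| minus the number of tokens of A on C. *)
Lemma has_type_compl_imp p A :
  has_type p (val A) -> has_type (TG_c kG p) (~: val A).
Proof.
move=> /has_typeP tA; apply/has_typeP => C CS.
rewrite [RHS](@raw_cE G (val p).1 (val p).2) // -tA //.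
by rewrite setIC -setDE cardsD setIC.
Qed.

Lemma has_type_compl p A :
  has_type (TG_c kG p) (val (tok_compl_fun A)) = has_type p (val A).
Proof.
apply/idP/idP; last exact: has_type_compl_imp.
by move/has_type_compl_imp; rewrite TG_cK /= setCK.
Qed.

Lemma tau_compl p : tau p ^ tok_compl = tau (TG_c kG p).
Proof.
apply: tau_conj => A; rewrite !permE; apply/val_inj/setP => z.
by rewrite mem_tau_fun has_type_compl /= !in_setC mem_tau_fun addNb.
Qed.

(** If A contains u and f u, then f u is missing from the complement of f(A), so f u would lie in a
    cut carrying exactly one token of A. Hence cuts cover all vertices. With three tokens, A could
    contain that whole cut, so k = 2; then n = 4 and two complementary cuts form a 4-cycle. *)
Lemma compl_iota_swap_of (v : base) f : tok_iota k f * tok_compl <> swap_of v.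
Proof.
move=> fv; have [k_gt0 k_lt] := andP hk.
have fA A : val (swap_of v A) = ~: (f @: val A) by rewrite -fv permM !permE.
have k_gt1 : 1 < k by move: hK2 k_gt0; rewrite -kG; case: (k) => [|[|]].
have flip u (A : {set G}) : #|A| = k -> u \in A -> f u \in A ->
    exists S, [/\ S \in same_nbr_cuts G, f u \in S & #|A :&: S| = 1%N].
  move=> /eqP cA uA fuA; have := @swap_of_flip v (Sub A cA) (f u).
  rewrite fA SubK in_setC imset_f // fuA => /(_ isT)[S [SQ fS AS _]].
  by exists S.
have pick (B : {set G}) : #|B| <= k -> exists2 A : {set G}, B \subset A & #|A| = k.
  move=> Bk; have [||A [BA _ cA]] := @subset_of_size _ B setT k; first exact: subsetT.
    by rewrite Bk cardsT ltnW.
  by exists A.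
have cut_at w : exists2 S, S \in same_nbr_cuts G & w \in S.
  rewrite -(permKV f w); set u := f^-1 w.
  have [|A uA cA] := pick [set u; f u].
    by rewrite cards2 (leq_trans _ k_gt1) // ltnS leq_b1.
  have [||S [SQ fS _]] := flip u A cA; last by exists S.
    by apply: (subsetP uA); rewrite !inE eqxx.
  by apply: (subsetP uA); rewrite !inE eqxx orbT.
have k2 : k = 2.
  apply/eqP; rewrite eqn_leq k_gt1 andbT leqNgt; apply/negP => k_gt2.
  have [u _] : exists u, u \in G by apply/card_gt0P; apply: leq_ltn_trans k_lt.
  have [S SQ fuS] := cut_at (f u).
  have [|A uA cA] := pick (u |: S).
    by rewrite cardsU1 card_same_nbr_cuts // (leq_trans _ k_gt2) // addn2 !ltnS leq_b1.
  have [||S' [SQ' fS' AS']] := flip u A cA.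
  - by apply: (subsetP uA); rewrite !inE eqxx.
  - by apply: (subsetP uA); rewrite !inE fuS orbT.
  move: AS'; rewrite -(cuts_disjoint Gconn SQ SQ' fuS fS') (setIidPr _).
    by rewrite card_same_nbr_cuts.
  by apply: subset_trans uA; apply: subsetUr.
have [u _] : exists u, u \in G by apply/card_gt0P; apply: leq_ltn_trans k_lt.
have [S SQ uS] := cut_at u.
have [a [b [aS bS nab]]] := cut_disconnected SQ.
have [S' SQ' aS'] := cut_at a.
have nSS' : S != S' by apply: contraNneq aS => ->.
(* Here n = 2k = 4, so two disjoint cuts exhaust the vertices; S then separates the vertices a and b
   of S'. *)
have SS' : S' = ~: S.
  apply/eqP; rewrite eqEcard cardsCs setCK !card_same_nbr_cuts // -kG k2 andbT.
  by apply/subsetP => z zS'; rewrite in_setC (cuts_mem Gconn SQ SQ' nSS').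
have bS' : b \in S' by rewrite SS' in_setC.
by apply: hC4; have [] := split_cut_cycle4 Gconn SQ SQ' nSS' aS' bS' nab.
Qed.
End Complement.

(** * The wreath products *)

(** Compatibility of the action with conjugation makes the product of the two morphisms a morphism
    on the external semidirect product; the trivial intersection of the images makes it
    injective. *)
Lemma sdprod_image (gT aT rT : finGroupType) (H : {group gT}) (K : {group aT})
    (to : groupAction K H) (fH : {morphism H >-> rT}) (fK : {morphism K >-> rT}) :
  'injm fH -> 'injm fK -> {in H & K, morph_act to 'J fH fK} ->
  fH @* H :&: fK @* K = 1 ->
  exists Gc : {group rT}, Gc = fH @* H * fK @* K :> {set rT} /\
    Gc \isog [set: sdprod_by to].
Proof.
move=> injH injK actf TI; exists (xsdprodm actf @* setT)%G.
split; first exact: im_xsdprodm.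
by rewrite isog_sym sub_isog // injm_xsdprodm injH injK TI eqxx.
Qed.
(** The common core of both cases: K is either [iotaS] or its product with Z_2, and the subgroup is
    the image of the base group times the image of K. *)
Lemma wreath_subgroup (aT : finGroupType) (K : {group aT})
    (to : action K (TG G k)) (h : {morphism K >-> {perm token_vertex G k}}) :
  'injm h -> h @* K \subset aut_rel (@token_edge G k) ->
  (forall p a, a \in K -> tau p ^ h a = tau (to p a)) ->
  (forall (v : base) a, a \in K -> h a = swap_of v -> h a = 1) ->
  iotaS k x \subset h @* K ->
  exists Gc : {group {perm token_vertex G k}},
    [/\ Gc \subset aut_rel (@token_edge G k),
        Gc \isog [set: wreathZ2 to]
      & tok_iota k @* 'Aut G \subset Gc].
Proof.
move=> inj_h h_aut h_tau h_swap iotaS_h.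
have actf : {in [set: wbase] & K,
    morph_act (wr_groupAction to) 'J swap_of_morphism h}.
  move=> v a _ Ka; rewrite /= -(@swap_of_conj _ K to v a (h a)) // => p.
  exact: h_tau.
have TI : swap_of_morphism @* [set: wbase] :&: h @* K = 1.
  apply/trivgP/subsetP => g /setIP[/morphimP[v _ _ gv] /morphimP[a _ Ka ga]].
  by rewrite inE ga (h_swap v a) // -ga gv.
have [Gc [GcE Giso]] := sdprod_image injm_swap_of inj_h actf TI.
exists Gc; split=> //.
  rewrite GcE mul_subG //; apply/subsetP => _ /morphimP[v _ _ ->].
  exact: swaps_aut.
apply: tok_iota_gen => [v|].
  rewrite -[_ \in _]/(_ \in (Gc : {set _})) GcE.
  by apply: (subsetP (mulG_subl _ _)); apply: mem_morphim.
by rewrite GcE (subset_trans iotaS_h) // mulG_subr.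
Qed.

Lemma iotaS_swap_of (v : base) g : g \in iotaS k x -> g = swap_of v -> g = 1.
Proof.
case/morphimP=> f _ fS -> /= fv; rewrite (label_pres_swap_of fS fv).
exact: morph1.
Qed.

Lemma tau_iotaS p g : g \in iotaS k x -> tau p ^ g = tau (iotaS_action x hk p g).
Proof.
case/morphimP=> f fG _ ->; transitivity (tau (TG_action G k p f)).
  exact: tau_iota.
by rewrite -(iotaS_actionE x hk p fG).
Qed.

Lemma iotaS_aut : iotaS k x \subset aut_rel (@token_edge G k).
Proof. by apply/subsetP => _ /morphimP[f fG _ ->]; apply: tok_iota_aut. Qed.

Section ComplementSubgroup.
Hypothesis kG : k.*2 = #|G|.

Definition with_compl (q : {perm token_vertex G k} * 'Z_2) :=
  q.1 * (if q.2 == 0%R then 1 else tok_compl kG).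

Lemma tok_compl_iotaS g : g \in iotaS k x -> tok_compl kG * g = g * tok_compl kG.
Proof. by case/morphimP=> f _ _ -> /=; apply: tok_compl_iota. Qed.

(** Complementation is an involution commuting with all of [iotaS]. *)
Lemma with_complM :
  {in setX (iotaS k x) [set: 'Z_2] &, {morph with_compl : q r / q * r}}.
Proof.
move=> [g a] [h b] /setXP[/= gS _] /setXP[/= hS _]; rewrite /with_compl /=.
case: a b => [[|[|//]] ?] [[|[|//]] ?] /=; rewrite ?mulg1 ?mulgA //.
  by rewrite -!mulgA (tok_compl_iotaS hS).
by rewrite -(mulgA g) (tok_compl_iotaS hS) -!mulgA tok_compl2 mulg1.
Qed.
Canonical with_compl_morphism := Morphism with_complM.

Lemma with_compl_swap_of (v : base) r : r \in setX (iotaS k x) [set: 'Z_2] ->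
  with_compl r = swap_of v -> r = 1.
Proof.
case: r => [g a] /setXP[/= gS _]; rewrite /with_compl /=.
have [->|a1] := eqVneq a 0%R; first by rewrite mulg1 => /(iotaS_swap_of gS)->.
by case/morphimP: gS => f _ _ -> /compl_iota_swap_of.
Qed.

(** The identity is the composite of exchanges for the zero vector, so [with_compl_swap_of] already
    shows that the kernel is trivial. *)
Lemma injm_with_compl : 'injm with_compl_morphism.
Proof.
apply/subsetP => r /morphpreP[rK /set1P r1]; apply/set1P.
by apply: with_compl_swap_of rK _; rewrite [LHS]r1; apply/esym/(morph1 swap_of_morphism).
Qed.

Lemma tau_with_compl p r : r \in setX (iotaS k x) [set: 'Z_2] ->
  tau p ^ with_compl r = tau (iotaS_Z2_action x hk kG p r).
Proof.
case: r => [g a] /setXP[/= gS _]; rewrite /with_compl /= /prodZ2_act /=.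
case: ifP => _; rewrite ?mulg1 ?conjgM tau_iotaS //; exact: tau_compl.
Qed.
Lemma wreath_subgroup_compl : exists Gc : {group {perm token_vertex G k}},
  [/\ Gc \subset aut_rel (@token_edge G k),
      Gc \isog [set: wreathZ2 (iotaS_Z2_action x hk kG)]
    & tok_iota k @* 'Aut G \subset Gc].
Proof.
apply: (wreath_subgroup injm_with_compl) => [|p a|v a aK|].
- apply/subsetP => _ /morphimP[[g a] _ gaK ->].
  case/setXP: gaK => /= gS _; apply: groupM.
    exact: (subsetP iotaS_aut) gS.
  by case: ifP => _; [apply: group1 | apply: tok_compl_aut].
- exact: tau_with_compl.
- by move/(with_compl_swap_of aK)->; apply: (morph1 with_compl_morphism).
- apply/subsetP => g gS; apply/morphimP; exists (g, 0%R).
  + by rewrite !inE gS.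
  + by rewrite !inE gS.
  + by rewrite /= /with_compl eqxx mulg1.
Qed.
End ComplementSubgroup.

Lemma wreath_subgroup_iotaS : exists Gc : {group {perm token_vertex G k}},
  [/\ Gc \subset aut_rel (@token_edge G k),
      Gc \isog [set: wreathZ2 (iotaS_action x hk)]
    & tok_iota k @* 'Aut G \subset Gc].
Proof.
apply: (wreath_subgroup (injm_idm (iotaS k x))) => [|p g|v g|].
- by rewrite im_idm iotaS_aut.
- exact: tau_iotaS.
- exact: iotaS_swap_of.
- by rewrite im_idm.
Qed.
End Swaps.

Theorem theorem6 (G : sgraph) (Gconn : connected_graph G)
    (k : nat) (hk : 0 < k < #|G|)
    (hK2 : #|G| != 2) (hC4 : ~ (k = 2 /\ is_cycle4 G))
    (x y : {set G} -> G)
    (hxy : forall S, S \in same_nbr_cuts G -> S = [set x S; y S]) :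
  exists Gc : {group {perm token_vertex G k}},
    [/\ Gc \subset aut_rel (@token_edge G k),
        k.*2 != #|G| -> Gc \isog [set: wreathZ2 (iotaS_action x hk)],
        forall kG : k.*2 = #|G|,
          Gc \isog [set: wreathZ2 (iotaS_Z2_action x hk kG)]
      & @tok_iota G k @* 'Aut G \subset Gc].
Proof.
have [kG|kG] := eqVneq k.*2 #|G|.
  have [Gc [Gaut Giso Giota]] := wreath_subgroup_compl Gconn hk hC4 hxy hK2 kG.
  (* The action depends on a proof of k = n/2; any two such proofs are equal. *)
  by exists Gc; split=> // kG'; rewrite (eq_irrelevance kG' kG).
have [Gc [Gaut Giso Giota]] := wreath_subgroup_iotaS Gconn hk hC4 hxy.
by exists Gc; split=> // kG'; rewrite kG' eqxx in kG.
Qed.
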